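(* Suppose that an integral domain $D$ contains a nonzero nonunit comparable element $x$ and let $Q:=\bigcap_{n\geq 0}x^nD$. Then $D$ is a valuation domain if and only if $D_Q$ is a valuation domain.
   Context: A nonzero element $c$ of an integral domain $D$ is comparable in $D$ if for every $y\in D$ one has $cD\subseteq yD$ or $yD\subseteq cD$. For a nonzero nonunit comparable element $x$, the ideal $Q=\bigcap_{n\ge 0}x^nD$ is a prime ideal of $D$, so the localization $D_Q$ makes sense. Fields are counted as valuation domains. *)

(* Defs.v *)
From HB Require Import structures.
From mathcomp Require Import all_boot all_algebra.
From mathcomp Require Import boolp classical_sets.

Set Implicit Arguments.
Unset Strict Implicit.
Unset Printing Implicit Defensive.

Import GRing.Theory.

Local Open Scope classical_set_scope.
Local Open Scope ring_scope.

Notation "x %:F" := (@FracField.tofrac _ x) : ring_scope.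

Definition principal_ideal (D : idomainType) (c : D) : set D :=
  [set c * r | r in [set: D]].

Definition comparable_element (D : idomainType) (c : D) : Prop :=
  c != 0 /\ forall y : D,
    principal_ideal c `<=` principal_ideal y \/
    principal_ideal y `<=` principal_ideal c.

(* No nondegeneracy condition, so every field qualifies. *)
Definition valuation_domain (V : idomainType) : Prop :=
  forall z : {fraction V}, z != 0 ->
    (exists a : V, z = a%:F) \/ (exists a : V, z^-1 = a%:F).

(* The localization D_P, as the subring of the fraction field of D formed by  *)
(* the a / s with s outside P.                                                *)
Section Localization.
Variables (D : idomainType) (P : prime_idealr D).

Definition in_localization : {pred {fraction D}} :=
  fun z => `[< exists a s : D, s \notin P /\ z = a%:F / s%:F >].

Lemma notin_prime_neq0 (s : D) : s \notin P -> s%:F != 0.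
Proof.
by rewrite tofrac_eq0; apply: contraNneq => ->; rewrite rpred0.
Qed.

Lemma in_localization_subring : subring_closed in_localization.
Proof.
split.
- apply/asboolP; exists 1, 1; split; first by rewrite idealr1.
  by rewrite divr1.
- move=> _ _ /asboolP[a [s [sP ->]]] /asboolP[b [t [tP ->]]].
  apply/asboolP; exists (a * t - b * s), (s * t); split.
    by rewrite prime_idealrM negb_or sP.
  by rewrite rmorphB !rmorphM /= -[- (_ / _)]mulNr addf_div ?notin_prime_neq0 // mulNr.
- move=> _ _ /asboolP[a [s [sP ->]]] /asboolP[b [t [tP ->]]].
  apply/asboolP; exists (a * b), (s * t); split.
    by rewrite prime_idealrM negb_or sP.
  by rewrite !rmorphM /= mulf_div.
Qed.

HB.instance Definition _ :=
  GRing.isSubringClosed.Build _ in_localization in_localization_subring.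

Record localization := Localization {
  localization_val :> {fraction D};
  localization_valP : localization_val \in in_localization }.

HB.instance Definition _ := [isSub for localization_val].
HB.instance Definition _ := [Choice of localization by <:].
HB.instance Definition _ :=
  [SubChoice_isSubComNzRing of localization by <:].

Definition localization_unit : {pred localization} :=
  fun z => (z != 0) && ((val z)^-1 \in in_localization).

(* insubd makes this the identity when (val z)^-1 is outside D_P. *)
Definition localization_inv (z : localization) : localization :=
  insubd z (val z)^-1.

Lemma localization_mulVr :
  {in localization_unit, left_inverse 1 localization_inv *%R}.
Proof.
move=> z /andP[z0 zV]; apply: val_inj.
by rewrite rmorphM rmorph1 /= val_insubd zV mulVf.
Qed.

Lemma localization_unitPl (z w : localization) :
  w * z = 1 -> localization_unit z.
Proof.
move=> wz1; have /(congr1 val) := wz1; rewrite rmorphM rmorph1 /= => wz.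
apply/andP; split.
  by apply: contra_eq_neq wz1 => ->; rewrite mulr0 eq_sym oner_eq0.
have z0 : val z != 0.
  by apply: contra_eq_neq wz => /= ->; rewrite mulr0 eq_sym oner_eq0.
suff -> : (val z)^-1 = val w by exact: localization_valP.
by apply: (mulIf z0); rewrite mulVf.
Qed.

Lemma localization_inv_out :
  {in [predC localization_unit], localization_inv =1 id}.
Proof.
move=> z; rewrite inE /= unfold_in negb_and negbK => /orP[/eqP->|zV].
  by apply: val_inj; rewrite val_insubd rmorph0 invr0 if_same.
by apply: val_inj; rewrite val_insubd (negPf zV).
Qed.

HB.instance Definition _ := GRing.ComNzRing_hasMulInverse.Build localization
  localization_mulVr localization_unitPl localization_inv_out.

Lemma localization_integral : GRing.integral_domain_axiom localization.
Proof.
move=> z w /(congr1 val) /eqP; rewrite rmorphM rmorph0 /= mulf_eq0.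
by case/orP => /eqP e; apply/orP; [left|right]; apply/eqP/val_inj.
Qed.

HB.instance Definition _ :=
  GRing.ComUnitRing_isIntegral.Build localization localization_integral.

End Localization.

Section PowerIdeal.
Variables (D : idomainType) (x : D).

Definition power_ideal : {pred D} :=
  fun y => y \in \bigcap_(n in [set: nat]) principal_ideal (x ^+ n).

Lemma power_idealP (y : D) :
  reflect (forall n, exists r, y = x ^+ n * r) (y \in power_ideal).
Proof.
apply: (iffP idP) => [/set_mem yQ n|yQ].
  by have [r _ <-] := yQ n I; exists r.
by apply/mem_set => n _; have [r ->] := yQ n; exists r.
Qed.

Hypotheses (xc : comparable_element x) (xU : x \isn't a GRing.unit).

Lemma comparable_powers (n : nat) (y : D) :
  (exists r, y = x ^+ n * r) \/ (exists r, x ^+ n = y * r).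
Proof.
have [x0 xy] := xc; elim: n y => [|n IHn] y.
  by left; exists y; rewrite mul1r.
have [/(_ x)|/(_ y)] := xy y.
- case; first by exists 1 => //; rewrite mulr1.
  by move=> r _ yr; right; exists (r * x ^+ n); rewrite exprS -{1}yr mulrA.
- case; first by exists 1 => //; rewrite mulr1.
  move=> y' _ <-; have [[r ->]|[r e]] := IHn y'.
    by left; exists r; rewrite exprS mulrA.
  by right; exists r; rewrite exprS e mulrA.
Qed.

Lemma power_ideal_zmod : zmod_closed power_ideal.
Proof.
split=> [|a b /power_idealP aQ /power_idealP bQ]; apply/power_idealP => n.
  by exists 0; rewrite mulr0.
by have [r ->] := aQ n; have [s ->] := bQ n; exists (r - s); rewrite mulrBr.
Qed.

Lemma power_ideal_proper : 1 \notin power_ideal /\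
  forall a, {in power_ideal, forall b, a * b \in power_ideal}.
Proof.
split=> [|a b /power_idealP bQ].
  apply: contra xU => /power_idealP /(_ 1%N) [r]; rewrite expr1 => e.
  by apply/unitrPr; exists r.
by apply/power_idealP => n; have [r ->] := bQ n; exists (a * r); rewrite mulrCA.
Qed.

Lemma power_ideal_prime : prime_idealr_closed power_ideal.
Proof.
have aux a : a \notin power_ideal -> exists n r, x ^+ n = a * r.
  move=> aQ; apply: contrapT => h; move/negP: aQ; apply; apply/power_idealP.
  move=> n; have [//|[r e]] := comparable_powers n a.
  by case: h; exists n, r.
move=> a b abQ; apply: contraT; rewrite negb_or => /andP[].
move=> /aux [n [r er]] /aux [m [s es]].
have /power_idealP /(_ (n + m).+1) [t et] := abQ.
have : x ^+ (n + m) * 1 = x ^+ (n + m) * (x * (t * r * s)).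
  by rewrite mulr1 {1}exprD er es mulrACA et exprSr !mulrA.
move/(mulfI (expf_neq0 _ xc.1)) => e.
by case/negP: xU; apply/unitrPr; exists (t * r * s).
Qed.

Definition power_prime : prime_idealr D := HB.pack power_ideal
  (GRing.isZmodClosed.Build D power_ideal power_ideal_zmod)
  (isProperIdeal.Build D power_ideal power_ideal_proper)
  (isPrimeIdealrClosed.Build D power_ideal power_ideal_prime).

End PowerIdeal.

(* Main.v *)
Require Import Defs.
From HB Require Import structures.
From mathcomp Require Import all_boot all_algebra.
From mathcomp Require Import boolp classical_sets.

(** The implication from [D] to [D_Q] holds for every prime: a valuation domain
    is one in which any two elements are comparable for divisibility, and
    clearing denominators transports this to any localization.

    The converse rests on the fact that every [s] outside [Q] is a comparable
    element.  Such an [s] divides a power of [x]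
    ([notin_power_ideal_dvd_power]); powers of [x] are comparable, and a divisor
    of a comparable element is comparable ([comparable_element_dvd]).
    Given [a] and [b] in [D], if [a] divides [b] in [D_Q], then [b s = a r] with
    [s] outside [Q].  Since [s] is comparable, either [s] divides [r], and then
    [a] divides [b], or [r] divides [s], and then [b] divides [a]
    ([valuation_domain_of_localization]). *)

Set Implicit Arguments.
Unset Strict Implicit.
Unset Printing Implicit Defensive.

Import GRing.Theory.

Local Open Scope ring_scope.

Definition dvd_total (D : idomainType) (a b : D) : Prop :=
  (exists r, b = a * r) \/ (exists r, a = b * r).

Lemma dvd_totalC (D : idomainType) (a b : D) : dvd_total a b -> dvd_total b a.
Proof. by case; [right|left]. Qed.

Lemma principal_ideal_subset (D : idomainType) (a b : D) :
  (principal_ideal a `<=` principal_ideal b)%classic <-> exists r, a = b * r.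
Proof.
split=> [/(_ a)|[r ->] _ [s _ <-]].
  by case; [exists 1; rewrite ?mulr1|move=> r _ <-; exists r].
by exists (r * s); rewrite ?mulrA.
Qed.

Lemma comparable_elementP (D : idomainType) (c : D) :
  comparable_element c <-> c != 0 /\ forall y, dvd_total c y.
Proof.
split=> -[c0 h]; split=> // y.
- by case: (h y) => /principal_ideal_subset ?; [right|left].
- by case: (h y) => /principal_ideal_subset ?; [right|left].
Qed.

(** If [c = s t], comparing [c] with [t y] and cancelling [t] compares [s] with
    [y]. *)
Lemma comparable_element_dvd (D : idomainType) (s t : D) :
  comparable_element (s * t) -> comparable_element s.
Proof.
move/comparable_elementP=> [st0 h]; apply/comparable_elementP.
move: st0; rewrite mulf_eq0 negb_or => /andP[s0 t0]; split=> // y.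
case: (h (y * t)) => -[r]; rewrite mulrAC => /(mulIf t0) e.
  by left; exists r.
by right; exists r.
Qed.

Lemma comparable_elementX (D : idomainType) (x : D) n :
  comparable_element x -> comparable_element (x ^+ n).
Proof.
move=> hx; apply/comparable_elementP; split; first exact: expf_neq0 hx.1.
exact: comparable_powers hx n.
Qed.

Lemma notin_power_ideal_dvd_power (D : idomainType) (x s : D) :
  comparable_element x -> s \notin power_ideal x ->
  exists n r, x ^+ n = s * r.
Proof.
move=> hx sQ; apply: contrapT => h; case/negP: sQ; apply/power_idealP => n.
have [//|[r e]] := comparable_powers hx n s.
by case: h; exists n, r.
Qed.

Lemma notin_power_ideal_comparable (D : idomainType) (x s : D) :
  comparable_element x -> s \notin power_ideal x -> comparable_element s.
Proof.
move=> hx /(notin_power_ideal_dvd_power hx)[n [r e]].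
by apply: (@comparable_element_dvd _ s r); rewrite -e;
  exact: comparable_elementX.
Qed.

Lemma fraction_quotient (D : idomainType) (z : {fraction D}) :
  exists a b : D, b != 0 /\ z = a%:F / b%:F.
Proof.
elim/quotW: z => r; exists (frac r).1, (frac r).2.
have d0 := denom_ratioP r; split=> //.
have dF0 : ((frac r).2)%:F != 0 by rewrite tofrac_eq0.
apply: (mulIf dF0); rewrite divfK //.
(* Exposes the quotient-level product, so that the equation can be checked on
   representatives. *)
change (FracField.mul (\pi r)%qT ((frac r).2)%:F = ((frac r).1)%:F).
rewrite !piE; apply/eqmodP; rewrite /= FracField.equivfE.
by rewrite !numden_Ratio ?mulf_neq0 ?oner_eq0 // !mulr1 mulrC.
Qed.

(** Replaces fractions by pairs of elements of [V], so that both directions of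
    the theorem become divisibility computations.  A zero element is divisible
    by everything, which covers the pairs without a nonzero quotient. *)
Lemma valuation_domainP (V : idomainType) :
  valuation_domain V <-> forall a b : V, dvd_total a b.
Proof.
split=> [hV a b|h z z0].
- have [->|a0] := eqVneq a 0; first by right; exists 0; rewrite mulr0.
  have [->|b0] := eqVneq b 0; first by left; exists 0; rewrite mulr0.
  have aF0 : a%:F != 0 by rewrite tofrac_eq0.
  have bF0 : b%:F != 0 by rewrite tofrac_eq0.
  have q0 : b%:F / a%:F != 0 by rewrite mulf_neq0 ?invr_eq0.
  case: (hV _ q0) => -[c].
  + move=> e; left; exists c; apply/eqP; rewrite -tofrac_eq rmorphM /= -e.
    by rewrite mulrC divfK.
  + rewrite invf_div => e; right; exists c; apply/eqP.
    by rewrite -tofrac_eq rmorphM /= -e mulrC divfK.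
- have [a [b [b0 ez]]] := fraction_quotient z.
  have bF0 : b%:F != 0 by rewrite tofrac_eq0.
  have aF0 : a%:F != 0 by apply: contraNneq z0 => a0; rewrite ez a0 mul0r.
  rewrite ez invf_div; case: (h a b) => -[r ->]; [right|left]; exists r.
  + by rewrite rmorphM mulrAC divff // mul1r.
  + by rewrite rmorphM mulrAC divff // mul1r.
Qed.

Section LocalizationValuation.
Variables (D : idomainType) (P : prime_idealr D).

Lemma localization_quotient (z : localization P) :
  exists a s : D, s \notin P /\ val z = a%:F / s%:F.
Proof. by have /asboolP := localization_valP z. Qed.

Lemma localization_mk (a s : D) :
  s \notin P -> exists z : localization P, val z = a%:F / s%:F.
Proof.
move=> sP; have h : a%:F / s%:F \in in_localization P.
  by apply/asboolP; exists a, s.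
by exists (Localization h).
Qed.

Lemma localization_dvd (a b s t r : D) (z w : localization P) :
    s \notin P -> t \notin P -> val z = a%:F / s%:F -> val w = b%:F / t%:F ->
  b * s = a * t * r -> exists u, w = z * u.
Proof.
move=> sP tP ez ew e; have [|u eu] := @localization_mk r 1.
  by rewrite idealr1.
exists u; apply: val_inj; rewrite rmorphM /= ez ew eu rmorph1 divr1.
rewrite mulrAC; apply/eqP.
rewrite eqr_div ?(notin_prime_neq0 sP, notin_prime_neq0 tP) //.
by rewrite -!rmorphM tofrac_eq e mulrAC.
Qed.

Lemma valuation_domain_localization :
  valuation_domain D -> valuation_domain (localization P).
Proof.
move=> /valuation_domainP hD; apply/valuation_domainP => z w.
have [a [s [sP ez]]] := localization_quotient z.
have [b [t [tP ew]]] := localization_quotient w.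
case: (hD (a * t) (b * s)) => -[r e]; [left|right].
- exact: localization_dvd sP tP ez ew e.
- exact: localization_dvd tP sP ew ez e.
Qed.

(** The relation [w = z u] with [u = r / s] reads [b s = a r] in [D].  The
    denominator [s] being comparable with [r], one of them cancels: this gives
    [b] as a multiple of [a] if [s] divides [r], and [a] as a multiple of [b] if
    [r] divides [s].  The direction of divisibility may therefore be reversed,
    hence the symmetric conclusion. *)
Lemma localization_dvd_descent (a b : D) (z w : localization P) :
    (forall s, s \notin P -> comparable_element s) ->
    val z = a%:F -> val w = b%:F -> (exists u, w = z * u) ->
  dvd_total a b.
Proof.
move=> hP ez ew [u /(congr1 val)]; rewrite rmorphM /= ez ew.
have [r [s [sP ->]]] := localization_quotient u.
have sF0 := notin_prime_neq0 sP.
move/(congr1 (fun y => y * s%:F)); rewrite -mulrA divfK // -!rmorphM.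
move/eqP; rewrite tofrac_eq => /eqP e.
have [s0 /(_ r)[] [k ek]] := (comparable_elementP s).1 (hP s sP).
- by left; exists k; apply: (mulIf s0); rewrite e ek mulrA mulrAC.
- have r0 : r != 0 by apply: contraNneq s0 => r0; rewrite ek r0 mul0r.
  right; exists k.
  by apply: (mulIf r0); rewrite -e ek mulrA mulrAC.
Qed.

(** For [P = Q], the hypothesis comes from the comparability of [x]; it is all
    that the descent from [D_Q] to [D] draws from [x]. *)
Lemma valuation_domain_of_localization :
    (forall s, s \notin P -> comparable_element s) ->
  valuation_domain (localization P) -> valuation_domain D.
Proof.
move=> hP /valuation_domainP hL; apply/valuation_domainP => a b.
have P1 : 1 \notin P by rewrite idealr1.
have [z ez] := localization_mk a P1; have [w ew] := localization_mk b P1.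
rewrite !rmorph1 !divr1 in ez ew.
case: (hL z w) => h; first exact: localization_dvd_descent hP ez ew h.
by apply: dvd_totalC; exact: localization_dvd_descent hP ew ez h.
Qed.

End LocalizationValuation.

Theorem proposition5p8 (D : idomainType) (x : D)
    (hx : comparable_element x) (hxU : x \isn't a GRing.unit) :
  let Q : prime_idealr D := power_prime hx hxU in
  valuation_domain D <-> valuation_domain (localization Q).
Proof.
move=> Q; split; first exact: valuation_domain_localization.
apply: valuation_domain_of_localization => s.
exact: notin_power_ideal_comparable.
Qed.
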